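(* Let $\mathbb{F}$ be an algebraically closed field of characteristic $0$. Let $\mathcal{E}$ be an idempotent evolution algebra over $\mathbb{F}$ with natural basis $e_1,\dots,e_n$ and structure matrix $A=(a_{ij})$, and let $\mathcal{D}$ be the diagonal automorphism subgroup of $\mathrm{Aut}(\mathcal{E})$. \begin{enumerate} \item The maximal possible order of $\mathcal{D}$ (over all such $n$-dimensional $\mathcal{E}$) is $2^n-1$. This maximal order is achieved by $\mathcal{E}$ if and only if there is a cyclic permutation $\sigma\in S_n$ of length $n$ such that, for all $1\le i,j\le n$, $a_{ij}\neq0\Leftrightarrow i=\sigma(j)$; and in this case $\mathcal{D}$ is cyclic of order $2^n-1$ and $\mathrm{Aut}(\mathcal{E})\cong C_{2^n-1}\rtimes C_n$ (a semidirect product). \item All $n$-dimensional idempotent evolution algebras $\mathcal{E}$ over $\mathbb{F}$ with $\mathcal{D}$ of maximal order are isomorphic to the one with structure matrix $A=P_\sigma$, where $\sigma=(1\,2\,\cdots\,n)$. \end{enumerate}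
   Context: An $n$-dimensional evolution algebra over a field $\mathbb{F}$ is a (not necessarily associative) commutative $\mathbb{F}$-algebra $\mathcal{E}$ that has a vector space basis $e_1,\dots,e_n$ (called a natural basis) with $e_ie_j=0$ for all $i\ne j$. The structure matrix of $\mathcal{E}$ with respect to this natural basis is the $n\times n$ matrix $A=(a_{ij})$ over $\mathbb{F}$ determined by $e_i^2=\sum_{j=1}^n a_{ji}e_j$ for $1\le i\le n$. The algebra $\mathcal{E}$ is called idempotent if $\mathcal{E}^2=\mathcal{E}$, where $\mathcal{E}^2$ is the linear span of all products; equivalently, $A$ is nonsingular. $\mathrm{Aut}(\mathcal{E})$ is the group of $\mathbb{F}$-algebra automorphisms of $\mathcal{E}$. The diagonal automorphism subgroup $\mathcal{D}$ is the subgroup of those automorphisms whose matrix with respect to the natural basis $e_1,\dots,e_n$ is diagonal. $C_m$ denotes the cyclic group of order $m$. For $\sigma\in S_n$, $P_\sigma$ is the permutation matrix whose $(i,j)$ entry is $1$ if $i=\sigma(j)$ and $0$ otherwise. *)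

(* Defs.v *)
From HB Require Import structures.
From mathcomp Require Import all_boot all_order all_fingroup all_algebra.
From mathcomp Require Import all_solvable all_classical.

Set Implicit Arguments.
Unset Strict Implicit.
Unset Printing Implicit Defensive.

Import GRing.Theory.
Local Open Scope ring_scope.

(* Finite-dimensional commutative, not necessarily associative algebras. *)
HB.mixin Record Vector_isCommNAAlg (F : fieldType) E of Vector F E := {
  amul : E -> E -> E;
  amulC : commutative amul;
  amul_linear : forall x, linear (amul x)
}.

#[short(type="commNAAlgType")]
HB.structure Definition CommNAAlg (F : fieldType) :=
  {E of Vector_isCommNAAlg F E & Vector F E}.

Section Algebra.
Variable F : fieldType.
Implicit Types E : commNAAlgType F.

Definition alg_square E : set E :=
  [set x : E | exists s : seq (E * E)%type, x \in <<[seq amul p.1 p.2 | p <- s]>>%VS].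
Arguments alg_square E : clear implicits.

Definition idempotent_alg E : Prop := alg_square E = setT.

Definition alg_isomorphic E E' : Prop :=
  exists f : 'Hom(E, E'),
    bijective f /\ forall x y, f (amul x y) = amul (f x) (f y).

Definition natural_basis E n (e : n.-tuple E) : Prop :=
  basis_of fullv e /\
  forall i j, i != j -> amul (tnth e i) (tnth e j) = 0.

(* The coordinates of e_i^2 form the i-th column. *)
Definition structure_mx E n (e : n.-tuple E) : 'M[F]_n :=
  \matrix_(j, i) coord e j (amul (tnth e i) (tnth e i)).

Definition alg_aut_pred E (f : 'End(E)) : bool :=
  `[< bijective f /\ forall x y, f (amul x y) = amul (f x) (f y) >].

Definition alg_aut E := {f : 'End(E) | alg_aut_pred f}.

HB.instance Definition _ E := Choice.on (alg_aut E).

Section AutGroup.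
Variable E : commNAAlgType F.
Implicit Types f g h : alg_aut E.

Lemma alg_aut_lker0 f : lker (val f) == 0%VS.
Proof. by apply/lker0P/bij_inj; case: f => f /= /asboolP[]. Qed.

Lemma alg_autM f x y : val f (amul x y) = amul (val f x) (val f y).
Proof. by case: f => f /= /asboolP[]. Qed.

Fact alg_aut1_subproof : alg_aut_pred (\1%VF : 'End(E)).
Proof.
apply/asboolP; split=> [|x y]; last by rewrite !id_lfunE.
by exists id => x; rewrite id_lfunE.
Qed.

Fact alg_autM_subproof f g : alg_aut_pred (val f \o val g)%VF.
Proof.
apply/asboolP; split=> [|x y]; last by rewrite !comp_lfunE !alg_autM.
have [kf kg] := (alg_aut_lker0 f, alg_aut_lker0 g).
exists (fun x => (val g)^-1%VF ((val f)^-1%VF x)) => x; rewrite comp_lfunE.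
  by rewrite !lker0_lfunK.
by rewrite !lker0_lfunVK.
Qed.

Fact alg_autV_subproof f : alg_aut_pred (val f)^-1%VF.
Proof.
have kf := alg_aut_lker0 f; apply/asboolP; split=> [|x y].
  by exists (val f) => x; rewrite (lker0_lfunK, lker0_lfunVK).
by apply: (lker0P kf); rewrite alg_autM !lker0_lfunVK.
Qed.

Definition aut_one : alg_aut E := Sub _ alg_aut1_subproof.
Definition aut_mul f g : alg_aut E := Sub _ (alg_autM_subproof f g).
Definition aut_inv f : alg_aut E := Sub _ (alg_autV_subproof f).

Fact aut_mulA : associative aut_mul.
Proof. by move=> f g h; apply: val_inj; rewrite /= comp_lfunA. Qed.
Fact aut_mul1 : left_id aut_one aut_mul.
Proof. by move=> f; apply: val_inj; rewrite /= comp_lfun1l. Qed.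
Fact aut_mulr1 : right_id aut_one aut_mul.
Proof. by move=> f; apply: val_inj; rewrite /= comp_lfun1r. Qed.
Fact aut_mulV : left_inverse aut_one aut_inv aut_mul.
Proof.
by move=> f; apply: val_inj; rewrite /= lker0_compVf ?alg_aut_lker0.
Qed.
Fact aut_mulrV : right_inverse aut_one aut_inv aut_mul.
Proof.
by move=> f; apply: val_inj; rewrite /= lker0_compfV ?alg_aut_lker0.
Qed.

HB.instance Definition _ :=
  isGroup.Build (alg_aut E) aut_mulA aut_mul1 aut_mulr1 aut_mulV aut_mulrV.

End AutGroup.

Definition aut_mx E n (e : n.-tuple E) (f : alg_aut E) : 'M[F]_n :=
  \matrix_(j, i) coord e j (val f (tnth e i)).

Definition diag_aut E n (e : n.-tuple E) : set (alg_aut E) :=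
  [set f | is_diag_mx (aut_mx e f)].

(* k is the maximum of the orders of the diagonal automorphism subgroups of
   the n-dimensional idempotent evolution algebras over F. *)
Definition max_diag_order (n k : nat) : Prop :=
  (exists (E : commNAAlgType F) (e : n.-tuple E),
     [/\ natural_basis e, idempotent_alg E & (diag_aut e #= `I_k)%card]) /\
  (forall (E : commNAAlgType F) (e : n.-tuple E),
     natural_basis e -> idempotent_alg E -> (diag_aut e #<= `I_k)%card).

(* The evolution algebra on F^n whose structure matrix with respect to the
   canonical basis is A; the dummy argument A carries the product. *)
Definition evo_alg n (A : 'M[F]_n) : Type := 'rV[F]_n.

HB.instance Definition _ n (A : 'M[F]_n) := Vector.on (evo_alg A).

Section EvoAlg.
Variables (n : nat) (A : 'M[F]_n).

Definition evo_mul (x y : evo_alg A) : evo_alg A :=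
  \sum_i (x 0 i * y 0 i) *: (col i A)^T.

Fact evo_mulC : commutative evo_mul.
Proof. by move=> x y; apply: eq_bigr => i _; rewrite mulrC. Qed.

Fact evo_mul_linear x : linear (evo_mul x).
Proof.
move=> a y z; rewrite /evo_mul scaler_sumr -big_split /=.
by apply: eq_bigr => i _; rewrite scalerA -scalerDl !mxE mulrDr mulrCA.
Qed.

HB.instance Definition _ :=
  Vector_isCommNAAlg.Build F (evo_alg A) evo_mulC evo_mul_linear.

Definition evo_basis : n.-tuple (evo_alg A) :=
  [tuple (delta_mx 0 i : 'rV[F]_n) | i < n].

Lemma evo_basisE (i : 'I_n) : evo_basis`_i = delta_mx 0 i.
Proof. by rewrite -[LHS](tnth_nth 0) tnth_mktuple. Qed.

Lemma evo_basis_free : free evo_basis.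
Proof.
apply/freeP => k; under eq_bigr do rewrite evo_basisE; move=> k0 i.
have /rowP/(_ i) := k0; rewrite summxE (bigD1 i) //= big1 => [|j ji].
  by rewrite !mxE !eqxx mulr1 addr0.
by rewrite !mxE eqxx eq_sym (negPf ji) mulr0.
Qed.

Lemma evo_basis_natural : natural_basis evo_basis.
Proof.
split=> [|i j ij].
  rewrite basisEfree evo_basis_free subvf size_tuple /=.
  by rewrite dimvf /dim /= mul1n.
rewrite !tnth_mktuple [LHS]big1 // => k _; rewrite !mxE !eqxx /=.
have [->|] := eqVneq k i; last by rewrite mul0r scale0r.
by rewrite (negPf ij) mulr0 scale0r.
Qed.

Lemma evo_structure_mx : structure_mx evo_basis = A.
Proof.
apply/matrixP=> j i; rewrite mxE tnth_mktuple.
suff -> : amul (delta_mx 0 i : evo_alg A) (delta_mx 0 i)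
          = \sum_(k < n) A k i *: evo_basis`_k.
  by rewrite coord_sum_free // evo_basis_free.
rewrite [LHS](bigD1 i) //= big1 => [|k ki]; last first.
  by rewrite !mxE eqxx (negPf ki) mul0r scale0r.
rewrite !mxE !eqxx mulr1 scale1r addr0 [LHS]row_sum_delta.
by apply: eq_bigr => k _; rewrite evo_basisE !mxE.
Qed.

End EvoAlg.

(* Unlike perm_mx s, whose (i, j) entry is s i == j. *)
Definition Pmx n (s : 'S_n) : 'M[F]_n := \matrix_(i, j) (i == s j)%:R.

End Algebra.

(* s is a cyclic permutation (c_1 c_2 ... c_n) of length n. *)
Definition full_cycle n (s : 'S_n) : Prop :=
  exists c : n.-tuple 'I_n, uniq c && fcycle s c.

(* (1 2 ... n): i is sent to i + 1 modulo n. *)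
Definition std_cycle n : 'S_n := perm (@ordS_inj n).

Definition cyclic_subset (G : groupType) (D : set G) : Prop :=
  exists g : G, D = [set x | exists k : nat, x = (g ^+ k)%g \/ x = (g ^- k)%g]%classic.

(* G is isomorphic to a semidirect product of C_m by C_k. *)
Definition isog_sdprod_cyclic (G : groupType) (m k : nat) : Prop :=
  exists (gT : finGroupType) (K H : {group gT}) (phi : {multiplicative G -> gT}),
    [/\ bijective phi, (K ><| H)%g = [set: gT]%SET,
        cyclic K /\ #|K| = m & cyclic H /\ #|H| = k].

(* Main.v *)
Require Import Defs.
From HB Require Import structures.
From mathcomp Require Import all_boot all_order all_fingroup all_algebra.
From mathcomp Require Import all_solvable all_classical.
From mathcomp Require Import finmap separable cyclotomic ring.
Set Implicit Arguments.
Unset Strict Implicit.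
Unset Printing Implicit Defensive.
Import GRing.Theory.
Local Open Scope ring_scope.

(** A diagonal automorphism [e_i |-> d_i e_i] satisfies [d_j = d_i ^ 2] whenever
    [a_ji <> 0].  As [A] is nonsingular, some permutation [s] has all [a_(s i) i]
    nonzero, so [d] solves the system [x_(s i) = x_i ^ 2].  On the solutions of
    that system every function is a combination of the [2 ^ n] squarefree
    monomials, so there are at most [2 ^ n] of them; [x = 0] is one, which leaves
    [2 ^ n - 1] for the group.  In case of equality the squarefree monomials are
    pairwise distinct as functions on the solutions: this forbids a second nonzero
    entry in a column ([x_j] would equal [x_(s i)]) and a proper [s]-invariant
    subset (its monomial would equal the product of all coordinates), so [s] is an
    [n]-cycle and is the support of [A].

    Conversely, when the support of [A] is an [n]-cycle, rescaling the basis gives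
    [u_i ^ 2 = u_(i + 1)] with cyclic indices.  The automorphisms are then exactly
    [u_j |-> x ^ (2 ^ j) u_(j + k)] with [x ^ (2 ^ n - 1) = 1]. *)

(** * Cardinality of sets through duplicate-free sequences *)

Lemma card_le_natP (T : choiceType) (A : set T) (k : nat) :
  (forall X : seq T, uniq X -> (forall x, x \in X -> A x) -> (size X <= k)%N) ->
  (A #<= `I_k)%card.
Proof.
move=> leA; have [finA|infA] := pselect (finite_set A); last first.
  have [B BA ltkB] := infinite_set_fset k.+1 infA.
  by have := leA B (fset_uniq B) BA; rewrite leqNgt ltkB.
have [m Am] := finA; rewrite (card_le_eql Am) card_le_II -(card_fset_set Am).
by apply: leA => // x; rewrite in_fset_set // => /set_mem.
Qed.

Lemma card_eq_nat_seq (T : choiceType) (A : set T) (k : nat) :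
  (A #= `I_k)%card ->
  exists X : seq T, [/\ uniq X, size X = k & forall x, x \in X <-> A x].
Proof.
move=> Ak; have finA : finite_set A by exists k.
exists (fset_set A); split; [exact: fset_uniq | exact: card_fset_set |] => x.
by rewrite in_fset_set //; split=> [/set_mem|/mem_set].
Qed.

(** * Counting the solutions of [x (s i) = x i ^+ 2] *)

Section SquareSystem.
Variables (F : fieldType) (n : nat) (s : 'I_n -> 'I_n).
Implicit Types (A B : {set 'I_n}) (x : {ffun 'I_n -> F}).

Definition sqf_monomial A x : F := \prod_(i in A) x i.

Variable X : seq {ffun 'I_n -> F}.
Hypothesis uX : uniq X.
Hypothesis Xs : forall x i, x \in X -> x (s i) = x i ^+ 2.

(** Row vectors stand for functions on [X]: the row space of [M] is the span of the squarefree
    monomials, and right multiplication by [diag_mx (coordX i)] multiplies a function by the [i]-th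
    coordinate. *)
Let M : 'M[F]_(#|{: {set 'I_n}}|, size X) :=
  \matrix_(a, p) sqf_monomial (enum_val a) X`_p.
Let coordX i : 'rV[F]_(size X) := \row_p X`_p i.

Let row_monomial A : row (enum_rank A) M = \row_p sqf_monomial A X`_p.
Proof. by apply/rowP=> p; rewrite !mxE enum_rankK. Qed.

(* The relation [x_i ^ 2 = x_(s i)] trades the monomial of [A], multiplied by
   some [x_i] with [i \in A], for a smaller monomial multiplied by [x_(s i)]. *)
Let mul_coord_sub A i : (row (enum_rank A) M *m diag_mx (coordX i) <= M)%MS.
Proof.
have [k leAk] := ubnP #|A|; elim: k => // k IHk in A i leAk *.
have [iA|iA] := boolP (i \in A); last first.
  apply: eq_row_sub (enum_rank (i |: A)) _; rewrite !row_monomial.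
  apply/rowP=> p; rewrite mul_mx_diag !mxE /sqf_monomial.
  by rewrite big_setU1 //= mulrC.
suff -> : row (enum_rank A) M *m diag_mx (coordX i)
          = row (enum_rank (A :\ i)) M *m diag_mx (coordX (s i)).
  by apply: IHk; rewrite (cardsD1 i) iA in leAk.
rewrite !row_monomial.
apply/rowP=> p; rewrite !mul_mx_diag !mxE /sqf_monomial (big_setD1 i) //=.
by rewrite Xs ?mem_nth // expr2 -mulrA mulrCA.
Qed.

Let stable_coord i (v : 'rV_(size X)) :
  (v <= M)%MS -> (v *m diag_mx (coordX i) <= M)%MS.
Proof.
move=> vM; apply: submx_trans (submxMr _ vM) _; apply/row_subP=> a.
by rewrite row_mul -[a]enum_valK; apply: mul_coord_sub.
Qed.

(** Interpolation: start from the constant 1, the empty monomial, and for each [q] in [l] multiply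
    by [x_i - q_i], where [i] is a coordinate at which [p] and [q] differ. *)
Let separate (p : 'I_(size X)) (l : seq 'I_(size X)) : p \notin l ->
  exists v : 'rV_(size X), [/\ (v <= M)%MS, v 0 p != 0 &
    forall q, q \in l -> v 0 q = 0].
Proof.
elim: l => [|q l IHl] => [_|].
  exists (row (enum_rank finset.set0) M); split=> //; first exact: row_sub.
  by rewrite row_monomial mxE /sqf_monomial big_set0 oner_eq0.
rewrite inE negb_or => /andP[pq /IHl[v [vM vp vl]]].
have [i Xpq] : exists i, X`_p i != X`_q i.
  apply/existsP; apply: contraR pq; rewrite negb_exists => /forallP eqX.
  have : X`_p == X`_q.
    by apply/eqP/ffunP=> i; apply/eqP; have := eqX i; rewrite negbK.
  by rewrite nth_uniq.
exists (v *m diag_mx (coordX i) - X`_q i *: v); split=> [||r].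
- by rewrite addmx_sub ?eqmx_opp ?scalemx_sub ?stable_coord.
- by rewrite mul_mx_diag !mxE mulrC -mulrBl mulf_neq0 // subr_eq0.
rewrite inE => rql; rewrite mul_mx_diag !mxE mulrC -mulrBl.
by case/predU1P: rql => [->|/vl->]; rewrite ?subrr ?mul0r ?mulr0.
Qed.

(** A function vanishing at all points but [p] is a multiple of the indicator of [p]. *)
Let row_full_monomials : row_full M.
Proof.
rewrite -sub1mx; apply/row_subP=> p; rewrite row1.
have [|v [vM vp v0]] := @separate p (rem p (enum 'I_(size X))).
  by rewrite mem_rem_uniq ?enum_uniq // inE eqxx.
suff -> : delta_mx 0 p = (v 0 p)^-1 *: v by apply: scalemx_sub.
apply/rowP=> q; rewrite !mxE eqxx /=; have [->|qp] := eqVneq q p.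
  by rewrite mulVf.
rewrite (v0 q) ?mulr0 //.
by rewrite mem_rem_uniq ?enum_uniq // !inE qp mem_enum.
Qed.

Let card_monomials : #|{: {set 'I_n}}| = (2 ^ n)%N.
Proof. by rewrite -cardsT -powersetT card_powerset cardsT card_ord. Qed.

Lemma square_system_bound : (size X <= 2 ^ n)%N.
Proof. by rewrite -card_monomials -(eqP row_full_monomials) rank_leq_row. Qed.

(** With [2 ^ n] points, [M] has as many rows as columns, so full rank makes its rows independent,
    hence distinct. *)
Lemma square_system_free A B : size X = (2 ^ n)%N ->
  (forall x, x \in X -> sqf_monomial A x = sqf_monomial B x) -> A = B.
Proof.
move=> sX eqAB; apply: enum_rank_inj.
have freeM : row_free M.
  by rewrite /row_free (eqP row_full_monomials) sX -card_monomials.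
have : row (enum_rank A) M = row (enum_rank B) M.
  by rewrite !row_monomial; apply/rowP=> p; rewrite !mxE eqAB ?mem_nth.
rewrite !rowE => /(row_free_inj freeM)/rowP/(_ (enum_rank A)).
by rewrite !mxE !eqxx /=; case: eqVneq => // _ /eqP; rewrite oner_eq0.
Qed.

End SquareSystem.

(** * Finite copies of groups and semidirect products of cyclic groups *)

Section FiniteCopy.
Variables (G : groupType) (T : finType) (f : T -> G) (f' : G -> T).
Hypotheses (fK : cancel f f') (f'K : cancel f' f).
Local Open Scope group_scope.

Let copy_mul x y : T := f' (f x * f y).
Let copy_inv x : T := f' (f x)^-1.

Fact copy_mulA : associative copy_mul.
Proof. by move=> x y z; rewrite /copy_mul !f'K mulgA. Qed.
Fact copy_mul1 : left_id (f' 1) copy_mul.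
Proof. by move=> x; rewrite /copy_mul f'K mul1g fK. Qed.
Fact copy_mulV : left_inverse (f' 1) copy_inv copy_mul.
Proof. by move=> x; rewrite /copy_mul f'K mulVg. Qed.

(* The dummy arguments carry the group structure transported along [f]. *)
Definition finite_copy (_ : cancel f f') (_ : cancel f' f) : Type := T.
HB.instance Definition _ := Finite.on (finite_copy fK f'K).
HB.instance Definition _ := Finite_isGroup.Build (finite_copy fK f'K)
  copy_mulA copy_mul1 copy_mulV.

Definition to_finite_copy : G -> finite_copy fK f'K := f'.

Fact to_finite_copyM : {morph to_finite_copy : x y / x * y}.
Proof. by move=> x y; rewrite /to_finite_copy /mulg /= /copy_mul !f'K. Qed.
HB.instance Definition _ :=
  isMultiplicative.Build G (finite_copy fK f'K) to_finite_copy to_finite_copyM.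
HB.instance Definition _ := Multiplicative_isUMagmaMorphism.Build
  G (finite_copy fK f'K) to_finite_copy erefl.

End FiniteCopy.

(** The bijection gives the group [m * k] elements and makes it the product of [<[h]>] and [<[g]>].
    Their orders are at most [k] and [m], so by counting both are exact and the intersection is
    trivial; the relation on [g ^ h] gives normality. *)
Lemma isog_sdprod_cyclic_gen (G : groupType) (m k r : nat) (g h : G) :
  (g ^+ m)%g = 1%g -> (h ^+ k)%g = 1%g -> (g ^ h)%g = (g ^+ r)%g ->
  bijective (fun p : 'I_m * 'I_k => (h ^+ p.2 * g ^+ p.1)%g) ->
  isog_sdprod_cyclic G m k.
Proof.
set f := (X in bijective X) => gm hk gh bijf; have [f' fK f'K] := bijf.
pose phi : UMagmaMorphism.type G (finite_copy fK f'K) := to_finite_copy fK f'K.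
have defT : (<[phi h]> * <[phi g]>)%g = [set: finite_copy fK f'K]%SET.
  apply/finset.setP=> x; rewrite finset.inE; apply/imset2P.
  exists (phi h ^+ (x.2 : 'I_k))%g (phi g ^+ (x.1 : 'I_m))%g; rewrite ?mem_cycle //.
  by rewrite -!gmulfXn -gmulfM; apply/esym/fK.
have cardT : #|[set: finite_copy fK f'K]%SET| = (k * m)%N.
  by rewrite cardsT [LHS](card_prod 'I_m 'I_k) !card_ord mulnC.
have [og oh] : #[phi g]%g = m /\ #[phi h]%g = k.
  have m0 : (0 < m)%N.
    by case: (f' 1%g) => -[i im] _; apply: leq_ltn_trans im.
  have k0 : (0 < k)%N.
    by case: (f' 1%g) => _ [i im]; apply: leq_ltn_trans im.
  have gle : (#[phi g]%g <= m)%N.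
    by rewrite dvdn_leq // order_dvdn -gmulfXn gm gmulf1.
  have hle : (#[phi h]%g <= k)%N.
    by rewrite dvdn_leq // order_dvdn -gmulfXn hk gmulf1.
  have : (k * m <= #[phi h]%g * #[phi g]%g)%N.
    by rewrite mul_cardG defT cardT leq_pmulr.
  move=> le_km; split; apply/eqP; rewrite eqn_leq ?gle ?hle /=.
    by rewrite -(leq_pmul2l k0) (leq_trans le_km) // leq_mul2r hle orbT.
  by rewrite -(leq_pmul2r m0) (leq_trans le_km) // leq_mul2l gle orbT.
have tihg : (<[phi g]> :&: <[phi h]> = 1)%g.
  rewrite finset.setIC; apply: cardMg_TI.
  by rewrite defT cardT leq_mul -?orderE ?oh ?og.
have ngh : <[phi h]>%g \subset 'N(<[phi g]>)%g.
  by rewrite norms_cycle -gmulfJ gh gmulfXn mem_cycle.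
exists (finite_copy fK f'K), <[phi g]>%G, <[phi h]>%G, phi; split.
- by exists f.
- by rewrite sdprodE // -normC.
- by rewrite cycle_cyclic.
- by rewrite cycle_cyclic.
Qed.

(** * Roots of unity and indices modulo [n] *)

(** As [m] is nonzero in [F], ['X^m - 1] is separable; its [m] roots are distinct, so one of them is
    primitive. *)
Lemma exists_primitive_root (F : closedFieldType) (m : nat) :
  m%:R != 0 :> F -> exists z : F, m.-primitive_root z.
Proof.
move=> m0; have m_gt0 : (0 < m)%N by case: m m0 => [/eqP|].
pose p : {poly F} := 'X^m - 1; have [r Dp] := closed_field_poly_normal p.
rewrite (monicP _) ?monicXnsubC // scale1r in Dp.
have rm1 : all m.-unity_root r by apply/allP=> z; rewrite -root_prod_XsubC -Dp.
have sz_r : (m < (size r).+1)%N.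
  by rewrite -(size_prod_XsubC r id) -Dp size_XnsubC.
have [|z] := hasP (has_prim_root m_gt0 rm1 _ sz_r); last by exists z.
by rewrite -separable_prod_XsubC -Dp separable_Xn_sub_1.
Qed.

Lemma val_iter_ordS n (i : 'I_n) k : val (iter k (@ordS n) i) = ((i + k) %% n)%N.
Proof.
elim: k => [|k IHk] /=; first by rewrite addn0 modn_small.
by rewrite IHk -addn1 modnDml addn1 addnS.
Qed.

Lemma exp2_sub1_gt0 n : (0 < n)%N -> (0 < 2 ^ n - 1)%N.
Proof. by rewrite subn_gt0 -{2}(expn0 2) ltn_exp2l. Qed.

(** * Coordinates, diagonal automorphisms and the structure matrix *)

Section NaturalBasis.
Variables (F : fieldType) (E : commNAAlgType F).
Implicit Types x y : E.

HB.instance Definition _ x :=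
  GRing.isLinear.Build F E E *:%R (amul x) (amul_linear x).

Lemma amulZl a x y : amul (a *: x) y = a *: amul x y.
Proof. by rewrite amulC linearZ amulC. Qed.

Lemma amul_suml I r (P : pred I) (G : I -> E) y :
  amul (\sum_(i <- r | P i) G i) y = \sum_(i <- r | P i) amul (G i) y.
Proof. by rewrite amulC linear_sum; apply: eq_bigr => i _; rewrite amulC. Qed.

Variables (n : nat) (e : n.-tuple E).
Hypothesis basis_e : basis_of fullv e.

Lemma coord_fullv x : x = \sum_i coord e i x *: tnth e i.
Proof.
rewrite {1}(coord_basis basis_e (memvf x)).
by apply: eq_bigr => i _; rewrite (tnth_nth 0).
Qed.

Lemma coord_tnth i j : coord e i (tnth e j) = (j == i)%:R.
Proof. by rewrite (tnth_nth 0) coord_free ?(basis_free basis_e). Qed.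

Lemma coord_inj x y : (forall i, coord e i x = coord e i y) -> x = y.
Proof.
move=> eq_xy; rewrite (coord_fullv x) (coord_fullv y).
by under eq_bigr do rewrite eq_xy.
Qed.

Lemma lfun_basis_inj (V : vectType F) (f g : 'Hom(E, V)) :
  (forall i, f (tnth e i) = g (tnth e i)) -> f = g.
Proof.
move=> eq_fg; apply/lfunP => x; rewrite (coord_fullv x) !linear_sum.
by apply: eq_bigr => i _; rewrite !linearZ /= eq_fg.
Qed.

Lemma basis_monomial (c : 'I_n -> F) (t : 'I_n -> 'I_n) :
  (forall i, c i != 0) -> injective t ->
  basis_of fullv [tuple c i *: tnth e (t i) | i < n].
Proof.
move=> c0 injt; rewrite basisEdim size_tuple (size_basis basis_e) leqnn andbT.
apply/subvP=> x _; rewrite (coord_fullv x); apply: memv_suml => i _.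
have [t' _ t'K] := injF_bij injt; apply: memvZ; rewrite -[i]t'K.
suff -> : tnth e (t (t' i)) = (c (t' i))^-1 *: (c (t' i) *: tnth e (t (t' i))).
  apply/memvZ/memv_span/tnthP; exists (t' i); by rewrite tnth_mktuple.
by rewrite scalerA mulVf ?scale1r.
Qed.

Lemma diag_autP (f : alg_aut E) :
  diag_aut e f <->
  forall i, val f (tnth e i) = coord e i (val f (tnth e i)) *: tnth e i.
Proof.
split=> [/is_diag_mxP diag_f i|diag_f]; last first.
  apply/is_diag_mxP => j i ji; rewrite mxE diag_f linearZ /= coord_tnth.
  by rewrite -(inj_eq val_inj) eq_sym (negPf ji) mulr0.
rewrite [LHS]coord_fullv (bigD1 i) //= big1 ?addr0 // => j ji.
by have := diag_f j i ji; rewrite mxE => ->; rewrite scale0r.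
Qed.

(** This form depends only on the lines spanned by the basis vectors, which allows two bases to be
    compared. *)
Lemma diag_aut_eigenP (f : alg_aut E) :
  diag_aut e f <-> forall i, exists a, val f (tnth e i) = a *: tnth e i.
Proof.
split=> [/diag_autP diag_f i|eig_f]; first by eexists; apply: diag_f.
apply/diag_autP => i; have [a ->] := eig_f i.
by rewrite linearZ /= coord_tnth eqxx mulr1.
Qed.

Hypothesis natural_e : natural_basis e.

Lemma amul_natural x y :
  amul x y = \sum_i (coord e i x * coord e i y) *: amul (tnth e i) (tnth e i).
Proof.
rewrite {1}(coord_fullv x) amul_suml; apply: eq_bigr => i _.
rewrite amulZl {1}(coord_fullv y) linear_sum (bigD1 i) //= big1 ?addr0 => [|j ji].
  by rewrite linearZ scalerA.
by rewrite linearZ /= natural_e.2 ?scaler0 // eq_sym.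
Qed.

Lemma structure_mxP i :
  amul (tnth e i) (tnth e i) = \sum_j structure_mx e j i *: tnth e j.
Proof. by rewrite [LHS]coord_fullv; apply: eq_bigr => j _; rewrite mxE. Qed.

(** With [d] the diagonal of [f], comparing the [j]-th coordinates of [f (e_i ^ 2)] and
    [f (e_i) ^ 2] gives [d_j a_ji = d_i ^ 2 a_ji]. *)
Lemma diag_aut_square (f : alg_aut E) (i j : 'I_n) :
  diag_aut e f -> structure_mx e j i != 0 ->
  coord e j (val f (tnth e j)) = coord e i (val f (tnth e i)) ^+ 2.
Proof.
move=> /diag_autP diag_f aji0; apply: (mulIf aji0).
have : coord e j (val f (amul (tnth e i) (tnth e i)))
     = coord e j (amul (val f (tnth e i)) (val f (tnth e i))) by rewrite alg_autM.
rewrite {1 2}(diag_f i) amulZl !linearZ /= mulrA -expr2.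
(* A diagonal [f] multiplies the [j]-th coordinate of any vector by [d_j]. *)
have -> x : coord e j (val f x) = coord e j (val f (tnth e j)) * coord e j x.
  rewrite {1}(coord_fullv x) linear_sum linear_sum (bigD1 j) //=.
  rewrite big1 ?addr0 => [|k /negPf kj]; first by rewrite !linearZ /= mulrC.
  rewrite linearZ linearZ.
  transitivity (coord e k x * coord e j (coord e k (val f (tnth e k)) *: tnth e k)).
    by rewrite -diag_f.
  by rewrite linearZ /= coord_tnth kj !mulr0.
by rewrite mxE.
Qed.

Lemma diag_aut_coord_inj (f g : alg_aut E) : diag_aut e f -> diag_aut e g ->
  (forall i, coord e i (val f (tnth e i)) = coord e i (val g (tnth e i))) -> f = g.
Proof.
move=> /diag_autP diag_f /diag_autP diag_g eq_fg; apply/val_inj/lfun_basis_inj=> i.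
by rewrite diag_f diag_g eq_fg.
Qed.

Lemma alg_aut_tnth_neq0 (f : alg_aut E) i : val f (tnth e i) != 0.
Proof.
rewrite -memv_ker (eqP (alg_aut_lker0 f)) memv0; apply/eqP=> ei0.
by have := coord_tnth i i; rewrite ei0 linear0 eqxx => /esym/eqP; rewrite oner_eq0.
Qed.

Lemma diag_aut_coord_neq0 (f : alg_aut E) i :
  diag_aut e f -> coord e i (val f (tnth e i)) != 0.
Proof.
move=> /diag_autP diag_f; apply: contraNneq (alg_aut_tnth_neq0 f i) => f0.
by rewrite diag_f f0 scale0r.
Qed.

(** The squares [e_i ^ 2] span [E]; writing each [e_j] in them yields a right inverse [B] of the
    structure matrix. Its determinant is therefore nonzero, and so is some term of the Leibniz
    expansion. *)
Lemma idempotent_structure_perm : idempotent_alg E ->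
  exists s : 'S_n, forall i, structure_mx e (s i) i != 0.
Proof.
move=> idemE; pose w := [tuple amul (tnth e i) (tnth e i) | i < n].
have span_w x : x \in <<w>>%VS.
  have : @alg_square F E x by rewrite idemE.
  case=> s; apply/subvP/span_subvP => _ /mapP[p _ ->]; rewrite amul_natural.
  apply: memv_suml => i _; apply/memvZ/memv_span/tnthP; exists i.
  by rewrite tnth_mktuple.
pose B : 'M[F]_n := \matrix_(i, j) coord w i (tnth e j).
have AB1 : structure_mx e *m B = 1%:M.
  apply/matrixP=> k j; rewrite !mxE -eq_sym -coord_tnth.
  rewrite {1}(coord_span (span_w (tnth e j))) linear_sum; apply: eq_bigr => i _.
  by rewrite linearZ !mxE -[w`_i](tnth_nth _ w) tnth_mktuple mulrC.
have : \det (structure_mx e) != 0.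
  by have [+ _] := mulmx1_unit AB1; rewrite unitmxE unitfE.
rewrite /determinant => detA; have [s As] : exists s : 'S_n,
    \prod_i structure_mx e i (s i) != 0.
  apply/existsP; apply: contraR detA; rewrite negb_exists => /forallP A0.
  by rewrite big1 // => s _; have := A0 s; rewrite negbK => /eqP->; rewrite mulr0.
(* The Leibniz term runs over rows, the claim over columns, hence the inverse. *)
exists s^-1%g => i; have /prodf_neq0/(_ ((s^-1)%g i) isT) := As.
by rewrite permKV.
Qed.

End NaturalBasis.

(** * The bound [2 ^ n - 1] and the case of equality *)

Section DiagonalBound.
Variables (F : fieldType) (E : commNAAlgType F) (n : nat) (e : n.-tuple E).
Hypotheses (n_gt0 : (0 < n)%N) (natural_e : natural_basis e).
Let basis_e := natural_e.1.
Variable s : 'S_n.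
Hypothesis As : forall i, structure_mx e (s i) i != 0.
Variable X : seq (alg_aut E).
Hypotheses (uX : uniq X) (diagX : forall f, f \in X -> diag_aut e f).

Let point (f : alg_aut E) : {ffun 'I_n -> F} :=
  [ffun i => coord e i (val f (tnth e i))].

(* The zero vector also solves the square system, which improves the bound
   [2 ^ n] on the number of solutions by one. *)
Let points := 0 :: map point X.

Let uniq_points : uniq points.
Proof.
rewrite cons_uniq; apply/andP; split; last first.
  rewrite map_inj_in_uniq // => f g fX gX /ffunP eq_fg.
  apply: (diag_aut_coord_inj basis_e (diagX fX) (diagX gX)) => i.
  by have := eq_fg i; rewrite !ffunE.
apply/negP=> /mapP[f fX /ffunP/(_ (Ordinal n_gt0))]; rewrite !ffunE => /esym/eqP.
exact/negP/(diag_aut_coord_neq0 basis_e)/diagX.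
Qed.

Let square_points (x : {ffun 'I_n -> F}) i : x \in points -> x (s i) = x i ^+ 2.
Proof.
rewrite inE => /predU1P[->|/mapP[f fX ->]]; rewrite !ffunE ?expr0n //.
exact: (diag_aut_square basis_e (diagX fX)).
Qed.

Lemma diag_aut_size : (size X <= 2 ^ n - 1)%N.
Proof.
have := square_system_bound uniq_points square_points.
by rewrite /= size_map leq_subRL ?expn_gt0 // add1n.
Qed.

Hypothesis sX : size X = (2 ^ n - 1)%N.

(** Nonempty monomials vanish at the added zero point, so agreement has to be checked only on
    automorphisms. *)
Let monomial_inj A B : A != finset.set0 -> B != finset.set0 ->
  (forall f, f \in X -> sqf_monomial A (point f) = sqf_monomial B (point f)) ->
  A = B.
Proof.
move=> /finset.set0Pn[a aA] /finset.set0Pn[b bB] eqAB.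
apply: (square_system_free uniq_points square_points) => [|x].
  by rewrite /= size_map sX subn1 prednK // expn_gt0.
rewrite inE => /predU1P[->|/mapP[f fX ->]]; last exact: eqAB.
by rewrite /sqf_monomial (bigD1 a) // (bigD1 b bB) //= !ffunE !mul0r.
Qed.

Lemma max_diag_aut_support i j : structure_mx e j i != 0 -> j = s i.
Proof.
move=> aji; apply: finset.set1_inj; apply: monomial_inj => [||f /diagX fX].
- by apply/finset.set0Pn; exists j; rewrite finset.set11.
- by apply/finset.set0Pn; exists (s i); rewrite finset.set11.
rewrite /sqf_monomial !big_set1 !ffunE.
by rewrite (diag_aut_square basis_e fX aji) (diag_aut_square basis_e fX (As i)).
Qed.

(* The product [p] of the coordinates over an invariant set satisfies [p ^ 2 = p],
   so it is [1] on every diagonal automorphism. *)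
Lemma max_diag_aut_full_cycle : full_cycle s.
Proof.
have inv1 (A : {set 'I_n}) f : (forall i, (s i \in A) = (i \in A)) -> f \in X ->
    sqf_monomial A (point f) = 1.
  move=> sA fX; have p0 : sqf_monomial A (point f) != 0.
    apply/prodf_neq0 => i _; rewrite ffunE.
    exact: (diag_aut_coord_neq0 basis_e i (diagX fX)).
  apply: (mulfI p0); rewrite mulr1 -expr2 /sqf_monomial -prodrXl.
  rewrite [RHS](reindex_inj (@perm_inj _ s)) /=; apply: eq_big => [i|i _].
    by rewrite sA.
  by rewrite square_points // inE map_f ?orbT.
pose i0 := Ordinal n_gt0; pose O : {set 'I_n} := [set j | fconnect s i0 j]%SET.
have Oi0 : i0 \in O by rewrite finset.inE connect0.
(* Both sets are nonempty and invariant under [s], so both monomials are 1 on all of [X]. *)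
have defO : O = [set: 'I_n]%SET.
  apply: monomial_inj => [||f fX].
  - by apply/finset.set0Pn; exists i0.
  - by apply/finset.set0Pn; exists i0; rewrite finset.in_setT.
  rewrite !inv1 // => i; first by rewrite !finset.in_setT.
  by rewrite !finset.inE -same_fconnect1_r //; apply: perm_inj.
have sz_orbit : size (fingraph.orbit s i0) == n.
  rewrite size_orbit /order -[X in _ == X]card_ord -cardsT -defO.
  by apply/eqP/eq_card => j; rewrite [in RHS]finset.in_set.
by exists (Tuple sz_orbit); rewrite /= orbit_uniq cycle_orbit //; apply: perm_inj.
Qed.

End DiagonalBound.

(** * Bases with [u_i ^ 2 = u_(i + 1)], indices modulo [n] *)

(** The normal form of the extremal algebras: the structure matrix in [u] is
    [Pmx F (std_cycle n)]. *)
Definition cycle_basis (F : fieldType) (E : commNAAlgType F) n (u : n.-tuple E) :=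
  natural_basis u /\ forall i, amul (tnth u i) (tnth u i) = tnth u (ordS i).

Section CycleHom.
Variables (F : fieldType) (E E' : commNAAlgType F) (n : nat).
Variables (u : n.-tuple E) (u' : n.-tuple E').
Hypotheses (cycle_u : cycle_basis u) (cycle_u' : cycle_basis u').
Let basis_u := cycle_u.1.1.
Let basis_u' := cycle_u'.1.1.

Lemma coord_amul_cycle i x y :
  coord u (ordS i) (amul x y) = coord u i x * coord u i y.
Proof.
rewrite (amul_natural basis_u cycle_u.1) linear_sum (bigD1 i) //= big1 ?addr0.
  by rewrite linearZ /= cycle_u.2 coord_tnth // eqxx mulr1.
move=> j /negPf ji; rewrite linearZ /= cycle_u.2 coord_tnth //.
by rewrite (inj_eq (@ordS_inj n)) ji mulr0.
Qed.

Lemma basis_hom : exists f : 'Hom(E, E'), forall i, f (tnth u i) = tnth u' i.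
Proof.
have [f /(_ (basis_free basis_u))] := linear_of_free u u'.
rewrite !size_tuple => /(_ erefl) fu; exists (linfun f) => i; rewrite lfunE.
by rewrite (tnth_nth 0) -(nth_map _ 0) ?size_tuple // fu -tnth_nth.
Qed.

(** Such an [f] preserves coordinates, and both products have the same formula in coordinates. *)
Lemma cycle_hom_amul (f : 'Hom(E, E')) :
  (forall i, f (tnth u i) = tnth u' i) ->
  forall x y, f (amul x y) = amul (f x) (f y).
Proof.
move=> fu; have coord_f i x : coord u' i (f x) = coord u i x.
  rewrite {1}(coord_fullv basis_u x) !linear_sum (bigD1 i) //= big1 ?addr0.
    by rewrite !linearZ /= fu coord_tnth // eqxx mulr1.
  by move=> j /negPf ji; rewrite !linearZ /= fu coord_tnth // ji mulr0.
move=> x y; rewrite [in LHS](amul_natural basis_u cycle_u.1) linear_sum.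
rewrite [RHS](amul_natural basis_u' cycle_u'.1); apply: eq_bigr => i _.
by rewrite linearZ /= cycle_u.2 cycle_u'.2 fu !coord_f.
Qed.

End CycleHom.

Lemma cycle_isomorphism (F : fieldType) (E E' : commNAAlgType F) n
    (u : n.-tuple E) (u' : n.-tuple E') : cycle_basis u -> cycle_basis u' ->
  exists f : 'Hom(E, E'), [/\ bijective f,
    forall x y, f (amul x y) = amul (f x) (f y) &
    forall i, f (tnth u i) = tnth u' i].
Proof.
move=> cu cu'; have [f fu] := basis_hom u' cu; have [g gu] := basis_hom u cu'.
exists f; split=> //; last exact: (cycle_hom_amul cu cu').
exists g => x; rewrite -comp_lfunE.
  suff -> : (g \o f)%VF = \1%VF by rewrite id_lfunE.
  by apply: (lfun_basis_inj cu.1.1) => i; rewrite comp_lfunE fu gu id_lfunE.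
suff -> : (f \o g)%VF = \1%VF by rewrite id_lfunE.
by apply: (lfun_basis_inj cu'.1.1) => i; rewrite comp_lfunE gu fu id_lfunE.
Qed.

(** Building an automorphism thus reduces to exhibiting a second cycle basis of the same algebra. *)
Lemma cycle_automorphism (F : fieldType) (E : commNAAlgType F) n
    (u u' : n.-tuple E) :
  cycle_basis u -> cycle_basis u' ->
  exists f : alg_aut E, forall i, val f (tnth u i) = tnth u' i.
Proof.
move=> cu cu'; have [f [bijf fM fu]] := cycle_isomorphism cu cu'.
have autf : alg_aut_pred f by apply/asboolP.
by exists (exist _ f autf).
Qed.

(** * Rescaling a natural basis to a cycle basis *)

(** Take for [t i] the [i]-th iterate of [s] at the first entry [y] of the cycle. *)
Lemma full_cycle_ordS n (s : 'S_n) : full_cycle s ->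
  exists2 t : 'I_n -> 'I_n, injective t & forall i, s (t i) = t (ordS i).
Proof.
case=> -[c sz_c] /andP[/= uniq_c]; move: (eqP sz_c) uniq_c => {sz_c}.
case: c => [|y p] /= nE uniq_c.
  by exists id => // i; have := ltn_ord i; rewrite -{2}nE.
case/fpathP=> k def_p; have sz_p := congr1 size def_p.
rewrite size_rcons size_traject in sz_p; rewrite -sz_p trajectSr in def_p.
(* Closing the cycle gives [iter n s y = y], needed at the index [n - 1], whose successor is 0. *)
have [p_traj yE] := rcons_inj def_p; rewrite -iterSr nE in yE.
have c_traj : y :: p = traject s y n.
  have -> : traject s y n = traject s y (size p).+1 by rewrite nE.
  by rewrite trajectS -p_traj.
exists (fun i : 'I_n => iter i s y) => [i j|i] /=.
  rewrite -(nth_traject s (ltn_ord i)) -(nth_traject s (ltn_ord j)) -c_traj.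
  by move=> /eqP; rewrite nth_uniq //= ?nE ?ltn_ord // => /eqP/val_inj.
rewrite -iterS; have := ltn_ord i; rewrite leq_eqVlt => /predU1P[->|lt_ip].
  by rewrite modnn /= -yE.
by rewrite modn_small.
Qed.

(** For [u_i = c_i e_(t i)] the condition is [c_(i + 1) = c_i ^ 2 a_(t i)]. From [c_0 = z] it gives
    [c_k = z ^ (2 ^ k) C_k], where [C] is the solution with [C_0 = 1]; closing up requires
    [z ^ (2 ^ n) C_n = z]. *)
Lemma cycle_basis_exists (F : closedFieldType) (E : commNAAlgType F) n
    (n_gt0 : (0 < n)%N) (e : n.-tuple E) (s : 'S_n) : natural_basis e -> full_cycle s ->
    (forall i j, structure_mx e i j != 0 <-> i = s j) ->
  exists c t, [/\ forall i, c i != 0, injective t &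
    cycle_basis [tuple c i *: tnth e (t i) | i < n]].
Proof.
move=> nat_e /full_cycle_ordS[t injt st] supp.
pose a i := structure_mx e (s i) i; have a0 i : a i != 0 by apply/supp.
have sqe i : amul (tnth e i) (tnth e i) = a i *: tnth e (s i).
  rewrite (structure_mxP nat_e.1) (bigD1 (s i)) //= big1 ?addr0 // => j ji.
  have [->|/supp jE] := eqVneq (structure_mx e j i) 0; first by rewrite scale0r.
  by rewrite jE eqxx in ji.
pose i0 := Ordinal n_gt0.
(* [iter j (@ordS n) i0] is the number [j] read as an index modulo [n]. *)
pose C k : F := iteri k (fun j x => x ^+ 2 * a (t (iter j (@ordS n) i0))) 1.
have C0 k : C k != 0.
  by elim: k => [|k IHk]; rewrite ?oner_eq0 //= mulf_neq0 ?expf_neq0.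
have n2_gt0 := exp2_sub1_gt0 n_gt0.
(* This is the closing condition divided by [z], which excludes the root 0. *)
have [|z] := closed_rootP ('X^(2 ^ n - 1) - (C n)^-1%:P : {poly F}) _.
  by rewrite size_XnsubC // eqSS -lt0n.
rewrite /root !hornerE => /eqP/subr0_eq zE.
have z0 : z != 0.
  apply/eqP => z0; have /eqP := C0 n; apply; apply: invr_inj.
  by rewrite -zE z0 expr0n gtn_eqF // invr0.
have zC : z ^+ (2 ^ n) * C n = z.
  by rewrite -(subnK (expn_gt0 2 n)) addn1 exprS zE -mulrA mulVf ?mulr1.
exists (fun i : 'I_n => z ^+ (2 ^ i) * C i), t; split=> //.
  by move=> i; rewrite mulf_neq0 ?expf_neq0.
split; first split.
- by apply: (basis_monomial nat_e.1) => // i; rewrite mulf_neq0 ?expf_neq0.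
- move=> i j ij; rewrite !tnth_mktuple amulZl linearZ /= nat_e.2 ?scaler0 //.
  by rewrite inj_eq.
move=> i; rewrite !tnth_mktuple amulZl linearZ /= sqe st !scalerA; congr (_ *: _).
have iE : iter i (@ordS n) i0 = i.
  by apply/val_inj; rewrite val_iter_ordS /= add0n modn_small.
have cS : z ^+ (2 ^ i.+1) * C i.+1
    = z ^+ (2 ^ i) * C i * (z ^+ (2 ^ i) * C i * a (t i)).
  rewrite /C /= -/(C i) iE expnS mulnC exprM; ring.
rewrite -mulrA -cS; have := ltn_ord i; rewrite leq_eqVlt => /predU1P[->|lt_in].
  by rewrite modnn zC expn0 expr1 mulr1.
by rewrite modn_small.
Qed.

(** * The automorphism group of an algebra with a cycle basis *)

Lemma alg_autXE (F : fieldType) (E : commNAAlgType F) (f : alg_aut E) k x :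
  val (f ^+ k)%g x = iter k (val f) x.
Proof.
by elim: k => [|k IHk]; [rewrite id_lfunE | rewrite expgS comp_lfunE IHk].
Qed.

Section CycleAut.
Variables (F : closedFieldType) (E : commNAAlgType F) (n : nat) (u : n.-tuple E).
Hypotheses (charF0 : [pchar F] =i pred0) (n_gt0 : (0 < n)%N).
Hypothesis cycle_u : cycle_basis u.
Let basis_u := cycle_u.1.1.
Let i0 := Ordinal n_gt0.
Local Notation rot k := (iter k (@ordS n)).

Let rot_i0 (i : 'I_n) : rot i i0 = i.
Proof. by apply/val_inj; rewrite val_iter_ordS /= add0n modn_small. Qed.

Let rotC (k l : 'I_n) : rot k l = rot l k.
Proof. by apply/val_inj; rewrite !val_iter_ordS addnC. Qed.

Let rot_surj (k l : 'I_n) : exists j : 'I_n, rot j k = l.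
Proof.
have lt_j : ((l + (n - k)) %% n < n)%N by rewrite ltn_mod.
exists (Ordinal lt_j); apply/val_inj; rewrite val_iter_ordS /= modnDmr addnCA.
by rewrite subnKC ?modnDr ?modn_small // ltnW.
Qed.

(** Since [x ^ (2 ^ n) = x], the [j] in [x ^ (2 ^ j)] may be read modulo [n]. *)
Let expr_rot (x : F) (j : 'I_n) : x ^+ (2 ^ n - 1) = 1 ->
  x ^+ (2 ^ ordS j) = (x ^+ (2 ^ j)) ^+ 2.
Proof.
move=> x1; rewrite -exprM -expnSr /=; have := ltn_ord j; rewrite leq_eqVlt.
case/predU1P=> [jE|lt_jn]; last by rewrite modn_small.
by rewrite jE modnn expr1 -(subnK (expn_gt0 2 n)) addn1 exprSr x1 mul1r.
Qed.

(** The prescribed images form a cycle basis again, by [expr_rot]. *)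
Lemma cycle_aut_exists (x : F) (k : 'I_n) : x ^+ (2 ^ n - 1) = 1 ->
  exists f : alg_aut E,
    forall j, val f (tnth u j) = x ^+ (2 ^ j) *: tnth u (rot k j).
Proof.
move=> x1; pose u' := [tuple x ^+ (2 ^ j) *: tnth u (rot k j) | j < n].
have x0 : x != 0.
  apply: contra_eq_neq x1 => ->.
  by rewrite expr0n gtn_eqF ?exp2_sub1_gt0 // eq_sym oner_neq0.
have rot_inj : injective (rot k).
  by elim: {+}(val k) => //= m; apply/inj_comp/ordS_inj.
have cycle_u' : cycle_basis u'.
  split; first split.
  - by apply: (basis_monomial basis_u) => // i; rewrite expf_neq0.
  - move=> i j ij; rewrite !tnth_mktuple amulZl linearZ /= cycle_u.1.2 ?scaler0 //.
    by rewrite inj_eq.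
  move=> i; rewrite !tnth_mktuple amulZl linearZ /= cycle_u.2 scalerA -expr2.
  by rewrite expr_rot // -iterS iterSr.
have [f fu] := cycle_automorphism cycle_u cycle_u'.
by exists f => j; rewrite fu tnth_mktuple.
Qed.

(* Distinct columns of the matrix of [f] have disjoint supports, because
   [u_i u_j = 0].  As column [i + 1] is the shifted coordinatewise square of column [i], one nonzero
   entry [x] of column [0] produces a nonzero entry in every row. *)
Lemma cycle_aut_form (f : alg_aut E) : exists (x : F) (k : 'I_n),
  x ^+ (2 ^ n - 1) = 1 /\
  forall j, val f (tnth u j) = x ^+ (2 ^ j) *: tnth u (rot k j).
Proof.
pose b l j := coord u l (val f (tnth u j)).
have bS l j : b (ordS l) (ordS j) = b l j ^+ 2.
  by rewrite /b -cycle_u.2 alg_autM coord_amul_cycle.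
have bD l i j : i != j -> b l i * b l j = 0.
  by move=> ij; rewrite /b -coord_amul_cycle // -alg_autM cycle_u.1.2 // !linear0.
have [k bk0] : exists k, b k i0 != 0.
  apply/existsP; apply: contraR (alg_aut_tnth_neq0 basis_u f i0).
  rewrite negb_exists => /forallP b0; apply/eqP/(coord_inj basis_u) => l.
  by rewrite linear0; apply/eqP; have := b0 l; rewrite negbK.
set x := b k i0 in bk0; have b_rot m : b (rot m k) (rot m i0) = x ^+ (2 ^ m).
  by elim: m => //= m IHm; rewrite bS IHm -exprM -expnSr.
exists x, k; split=> [|j].
  (* After [n] shifts the entry is back in its place, so [x ^ (2 ^ n) = x]. *)
  apply: (mulfI bk0); rewrite mulr1 -exprS subn1 prednK ?expn_gt0 // -b_rot.
  have rot_n i : rot n i = i.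
    by apply/val_inj; rewrite val_iter_ordS modnDr modn_small.
  by rewrite !rot_n.
rewrite [LHS](coord_fullv basis_u) (bigD1 (rot k j)) //= big1 ?addr0 => [|l].
  by rewrite -/(b _ _) rotC -{2}(rot_i0 j) b_rot.
(* Column [l'] has a nonzero entry in row [l' + k], so the other column [j] vanishes in that row. *)
have [l' <-] := rot_surj k l; rewrite [rot k j]rotC => l'j.
have /(bD (rot l' k))/eqP : l' != j by apply: contraNneq l'j => ->.
rewrite mulf_eq0 -{2}(rot_i0 l') b_rot expf_eq0 (negPf bk0) andbF /= => /eqP bj0.
by rewrite -/(b _ _) bj0 scale0r.
Qed.

Lemma cycle_aut_generators : exists (w : F) (g h : alg_aut E),
  [/\ (2 ^ n - 1).-primitive_root w,
    forall a j, val (g ^+ a)%g (tnth u j) = (w ^+ a) ^+ (2 ^ j) *: tnth u j &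
    forall k j, val (h ^+ k)%g (tnth u j) = tnth u (rot k j)].
Proof.
have m_neq0 : (2 ^ n - 1)%:R != 0 :> F.
  have /pcharf0P-> := charF0.
  by rewrite -lt0n exp2_sub1_gt0.
have [w prim_w] := exists_primitive_root m_neq0.
have [g gu] := cycle_aut_exists i0 (prim_expr_order prim_w).
(* Reducing the shift 1 modulo [n] also covers [n = 1]. *)
have lt_1 : (1 %% n < n)%N by rewrite ltn_mod.
have [h hu] := cycle_aut_exists (Ordinal lt_1) (expr1n F _).
exists w, g, h; split=> // k j.
  rewrite alg_autXE; elim: k => [|k IHk] /=; first by rewrite expr0 expr1n scale1r.
  by rewrite IHk linearZ /= [sval g _]gu scalerA exprSr exprMn.
rewrite alg_autXE; elim: k => //= k ->; rewrite [sval h _]hu expr1n scale1r.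
by congr (tnth u _); apply/val_inj; rewrite val_iter_ordS /= modnDmr addn1.
Qed.

(** Both [g h] and [h g ^ 2] send [u_j] to [w ^ (2 ^ (j + 1)) u_(j + 1)], so conjugation by [h]
    squares [g], whence [r = 2]. By [cycle_aut_form] every automorphism is some [h ^ k g ^ a]. *)
Lemma cycle_aut_isog : isog_sdprod_cyclic (alg_aut E) (2 ^ n - 1) n.
Proof.
have [w [g [h [prim_w gu hu]]]] := cycle_aut_generators.
have w1 := prim_expr_order prim_w.
have hgu a k j : val (h ^+ k * g ^+ a)%g (tnth u j)
    = (w ^+ a) ^+ (2 ^ j) *: tnth u (rot k j).
  by rewrite comp_lfunE gu linearZ; congr (_ *: _); apply: hu.
have w0 : w != 0.
  apply: contra_eq_neq w1 => ->.
  by rewrite expr0n gtn_eqF ?exp2_sub1_gt0 // eq_sym oner_neq0.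
apply: (isog_sdprod_cyclic_gen (g := g) (h := h) (r := 2)).
- apply/val_inj/(lfun_basis_inj basis_u) => j.
  by rewrite gu w1 expr1n scale1r id_lfunE.
- apply/val_inj/(lfun_basis_inj basis_u) => j; rewrite hu id_lfunE.
  by congr tnth; apply/val_inj; rewrite val_iter_ordS modnDr modn_small.
- suff gh : (g * h = h * g ^+ 2)%g by rewrite conjgE gh mulKg.
  have gE j : val g (tnth u j) = w ^+ (2 ^ j) *: tnth u j.
    by have := gu 1%N j; rewrite expg1 expr1.
  have hE j : val h (tnth u j) = tnth u (ordS j).
    by have := hu 1%N j; rewrite expg1.
  apply/val_inj/(lfun_basis_inj basis_u) => j; rewrite !comp_lfunE hE !gE.
  rewrite !linearZ /= [sval g _]gE linearZ /= [sval h _]hE scalerA -expr2.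
  by rewrite expr_rot.
have /choice[f' f'K] (f : alg_aut E) : exists p : 'I_(2 ^ n - 1) * 'I_n,
    (h ^+ p.2 * g ^+ p.1)%g = f.
  have [x [k [x1 fu]]] := cycle_aut_form f.
  have [a xE] := prim_rootP prim_w x1; exists (a, k).
  apply/val_inj/(lfun_basis_inj basis_u) => j.
  by rewrite hgu fu xE.
exists f' => // -[a k].
set f := (h ^+ _ * _)%g; case: (f' f) (f'K f) => a' k' /=.
(* The [k]-th coordinate of the image of [u_0] is nonzero only for the shift [k], and its value then
   determines the exponent. *)
move=> /(congr1 (fun f : alg_aut E => coord u k (val f (tnth u i0)))).
rewrite !hgu !linearZ !rot_i0 /= !coord_tnth // eqxx !expn0 !expr1 mulr1.
have [-> /=|_] := eqVneq k' k; last first.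
  by rewrite mulr0 => /esym/eqP; rewrite expf_eq0 (negPf w0) andbF.
rewrite mulr1 => /eqP; rewrite (eq_prim_root_expr prim_w) !modn_small //.
by move=> /eqP/val_inj->.
Qed.

(** A diagonal automorphism has shift 0 in [cycle_aut_form], so it is a power of [g]. *)
Lemma cycle_diag_aut :
  cyclic_subset (diag_aut u) /\ (diag_aut u #= `I_(2 ^ n - 1))%card.
Proof.
have [w [g [h [prim_w gu _]]]] := cycle_aut_generators.
have w1 := prim_expr_order prim_w.
have diag_g a : diag_aut u (g ^+ a)%g.
  apply/(diag_autP basis_u) => j; rewrite gu linearZ /= coord_tnth // eqxx.
  by rewrite mulr1.
have gm : (g ^+ (2 ^ n - 1))%g = 1%g.
  apply/val_inj/(lfun_basis_inj basis_u) => j.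
  by rewrite gu w1 expr1n scale1r id_lfunE.
(* This turns the negative powers allowed by [cyclic_subset] into powers with natural exponents. *)
have gV : (g^-1 = g ^+ (2 ^ n - 1).-1)%g.
  apply/(mulgI g); rewrite mulgV -expgS prednK ?gm //.
  exact: exp2_sub1_gt0.
have diagP f : diag_aut u f -> exists2 a, (a < 2 ^ n - 1)%N & f = (g ^+ a)%g.
  move=> diag_f; have [x [k [x1 fu]]] := cycle_aut_form f.
  have [a xE] := prim_rootP prim_w x1; exists a => //.
  have k0 : k = i0.
    have := diag_aut_coord_neq0 basis_u i0 diag_f.
    rewrite fu linearZ /= coord_tnth // rot_i0; have [//|] := eqVneq k i0.
    by rewrite mulr0 eqxx.
  apply/val_inj/(lfun_basis_inj basis_u) => j.
  by rewrite fu gu xE k0.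
split.
  exists g; apply/seteqP; split=> f; first by case/diagP=> a _ ->; exists a; left.
  case=> a [->|->]; first exact: diag_g.
  by rewrite -expVgn gV -expgM.
have -> : diag_aut u = ((fun a => g ^+ a)%g @` `I_(2 ^ n - 1))%classic.
  apply/seteqP; split=> [f /diagP[a lt_a ->]|_ [a _ <-]]; first by exists a.
  exact: diag_g.
apply: inj_card_eq => a b /set_mem/= lt_a /set_mem/= lt_b.
move=> /(congr1 (fun f : alg_aut E => coord u i0 (val f (tnth u i0)))).
rewrite !gu !linearZ /= !coord_tnth // eqxx !mulr1 !expn0 !expr1 => /eqP.
by rewrite (eq_prim_root_expr prim_w) !modn_small // => /eqP.
Qed.

End CycleAut.

(** * Transfer between bases, and the conclusion *)

(** The new basis spans the same lines in another order, and being diagonal means preserving each of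
    these lines. *)
Lemma diag_aut_monomial (F : fieldType) (E : commNAAlgType F) n (e : n.-tuple E)
    (c : 'I_n -> F) (t : 'I_n -> 'I_n) :
  basis_of fullv e -> (forall i, c i != 0) -> injective t ->
  diag_aut [tuple c i *: tnth e (t i) | i < n] = diag_aut e.
Proof.
move=> basis_e c0 injt; have basis_u := basis_monomial basis_e c0 injt.
have [t' _ t'K] := injF_bij injt.
apply/seteqP; split=> f.
  move=> /(diag_aut_eigenP basis_u) eig_f; apply/(diag_aut_eigenP basis_e) => i.
  have [a fi] := eig_f (t' i); exists a; rewrite !tnth_mktuple t'K in fi.
  apply: (scalerI (c0 (t' i))); rewrite scalerA mulrC -scalerA -fi.
  by rewrite linearZ.
move=> /(diag_aut_eigenP basis_e) eig_f; apply/(diag_aut_eigenP basis_u) => i.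
have [a fi] := eig_f (t i); exists a; rewrite !tnth_mktuple linearZ /=.
by rewrite [sval f _]fi !scalerA mulrC.
Qed.

Lemma cycle_basis_idempotent (F : fieldType) (E : commNAAlgType F) n
    (u : n.-tuple E) :
  cycle_basis u -> idempotent_alg E.
Proof.
move=> cycle_u; apply/seteqP; split=> // x _.
exists [seq (tnth u i, tnth u i) | i <- enum 'I_n].
rewrite (coord_fullv cycle_u.1.1 x); apply: memv_suml => i _.
have [pred_i _ pred_iK] := injF_bij (@ordS_inj n).
apply/memvZ/memv_span/mapP; exists (tnth u (pred_i i), tnth u (pred_i i)).
  by apply/mapP; exists (pred_i i); rewrite ?mem_enum.
by rewrite cycle_u.2 pred_iK.
Qed.

Lemma evo_cycle_basis (F : fieldType) n :
  cycle_basis (evo_basis (Pmx F (std_cycle n))).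
Proof.
have nat_u := evo_basis_natural (Pmx F (std_cycle n)); split=> // i.
rewrite (structure_mxP nat_u.1) evo_structure_mx (bigD1 (ordS i)) //= big1 ?addr0.
  by rewrite mxE permE eqxx scale1r.
by move=> j /negPf ji; rewrite mxE permE ji scale0r.
Qed.

Lemma max_diag_aut_cycle (F : fieldType) (E : commNAAlgType F) n (e : n.-tuple E) :
  (0 < n)%N -> natural_basis e -> idempotent_alg E ->
  (diag_aut e #= `I_(2 ^ n - 1))%card ->
  exists s : 'S_n, full_cycle s /\
    forall i j : 'I_n, structure_mx e i j != 0 <-> i = s j.
Proof.
move=> n_gt0 nat_e idemE /card_eq_nat_seq[X [uX sX defX]].
have [s As] := idempotent_structure_perm nat_e.1 nat_e idemE.
have diagX f : f \in X -> diag_aut e f by move/defX.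
exists s; split; first exact: (max_diag_aut_full_cycle n_gt0 nat_e As uX diagX sX).
move=> i j; split=> [|->] //.
exact: (max_diag_aut_support n_gt0 nat_e As uX diagX sX).
Qed.

Theorem theorem4p1 (F : closedFieldType) (charF0 : [pchar F] =i pred0)
    (n : nat) (n_gt0 : (0 < n)%N) :
  (max_diag_order F n (2 ^ n - 1) /\
   forall (E : commNAAlgType F) (e : n.-tuple E),
     natural_basis e -> idempotent_alg E ->
     ((diag_aut e #= `I_(2 ^ n - 1))%card <->
        exists s : 'S_n, full_cycle s /\
          forall i j : 'I_n, structure_mx e i j != 0 <-> i = s j) /\
     ((diag_aut e #= `I_(2 ^ n - 1))%card ->
        cyclic_subset (diag_aut e) /\
        isog_sdprod_cyclic (alg_aut E) (2 ^ n - 1) n)) /\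
  (forall (E : commNAAlgType F) (e : n.-tuple E),
     natural_basis e -> idempotent_alg E ->
     (diag_aut e #= `I_(2 ^ n - 1))%card ->
     alg_isomorphic E (evo_alg (Pmx F (std_cycle n)))).
Proof.
(* Passing to a cycle basis leaves the set of diagonal automorphisms unchanged, so the claims can be
   proved there. *)
have normal_form (E : commNAAlgType F) (e : n.-tuple E) : natural_basis e ->
    (exists s : 'S_n, full_cycle s /\
       forall i j : 'I_n, structure_mx e i j != 0 <-> i = s j) ->
    exists2 u : n.-tuple E, cycle_basis u & diag_aut u = diag_aut e.
  move=> nat_e [s [cyc_s supp]].
  have [c [t [c0 injt cycle_u]]] := cycle_basis_exists n_gt0 nat_e cyc_s supp.
  exists [tuple c i *: tnth e (t i) | i < n] => //.
  exact: diag_aut_monomial nat_e.1 c0 injt.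
have cycle_std := evo_cycle_basis F n.
split; first split.
- split=> [|E e nat_e idemE].
    exists (evo_alg (Pmx F (std_cycle n))), (evo_basis (Pmx F (std_cycle n))).
    split; [exact: cycle_std.1 | exact: cycle_basis_idempotent cycle_std |].
    exact: (cycle_diag_aut charF0 n_gt0 cycle_std).2.
  apply: card_le_natP => X uX diagX.
  have [s As] := idempotent_structure_perm nat_e.1 nat_e idemE.
  exact: (diag_aut_size n_gt0 nat_e As uX diagX).
- move=> E e nat_e idemE; split.
    split=> [|/(normal_form _ _ nat_e)[u cycle_u <-]].
      exact: max_diag_aut_cycle.
    exact: (cycle_diag_aut charF0 n_gt0 cycle_u).2.
  move=> /(max_diag_aut_cycle n_gt0 nat_e idemE).
  move=> /(normal_form _ _ nat_e)[u cycle_u <-].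
  split; first exact: (cycle_diag_aut charF0 n_gt0 cycle_u).1.
  exact: cycle_aut_isog cycle_u.
move=> E e nat_e idemE.
move=> /(max_diag_aut_cycle n_gt0 nat_e idemE)/(normal_form _ _ nat_e)[u cycle_u _].
by have [f [bijf fM _]] := cycle_isomorphism cycle_u cycle_std; exists f.
Qed.
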